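(* There is a universal constant $C>0$ such that the following holds. Let $\mathbf{A}\in\mathbb{R}^{m\times n}$, $1\le k<\min(m,n)$, $f>1$, and let $\Pi_1,\Pi_2,\widehat{\mathbf{L}},\widehat{\mathbf{U}}$ be a rank-$k$ SRLU factorization of $\mathbf{A}$ produced by Spectrum-Revealing Pivoting (SRP) with tolerance $f$. Then there is a number $\gamma\le C f k\sqrt{mn}$ (that is, $\gamma=O(fk\sqrt{mn})$) such that $$\|\Pi_1\mathbf{A}\Pi_2^T-\widehat{\mathbf{L}}\widehat{\mathbf{U}}\|_2\le\gamma\,\sigma_{k+1}(\mathbf{A})$$ and, for all $1\le j\le k$, $$\|\Pi_1\mathbf{A}\Pi_2^T-(\widehat{\mathbf{L}}\widehat{\mathbf{U}})_j\|_2\le\sigma_{j+1}(\mathbf{A})\left(1+2\gamma\frac{\sigma_{k+1}(\mathbf{A})}{\sigma_{j+1}(\mathbf{A})}\right).$$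
   Context: A rank-$k$ truncated LU factorization of $\mathbf{A}\in\mathbb{R}^{m\times n}$ consists of permutation matrices $\Pi_1$ ($m\times m$) and $\Pi_2$ ($n\times n$) and an exact block factorization $$\Pi_1\mathbf{A}\Pi_2^T=\begin{pmatrix}\mathbf{L}_{11}&0\\ \mathbf{L}_{21}&\mathbf{I}_{m-k}\end{pmatrix}\begin{pmatrix}\mathbf{U}_{11}&\mathbf{U}_{12}\\0&\mathbf{S}\end{pmatrix},$$ where $\mathbf{L}_{11}\in\mathbb{R}^{k\times k}$ is lower triangular with unit diagonal, $\mathbf{L}_{21}\in\mathbb{R}^{(m-k)\times k}$, $\mathbf{U}_{11}\in\mathbb{R}^{k\times k}$ is upper triangular and nonsingular, $\mathbf{U}_{12}\in\mathbb{R}^{k\times(n-k)}$, and $\mathbf{S}\in\mathbb{R}^{(m-k)\times(n-k)}$ is the Schur complement. Set $\widehat{\mathbf{L}}=\begin{pmatrix}\mathbf{L}_{11}\\ \mathbf{L}_{21}\end{pmatrix}$ and $\widehat{\mathbf{U}}=\begin{pmatrix}\mathbf{U}_{11}&\mathbf{U}_{12}\end{pmatrix}$. Spectrum-Revealing Pivoting (SRP) with tolerance parameter $f>1$. Let $\alpha=\mathbf{S}_{pq}$ be an entry of $\mathbf{S}$ of largest absolute value (assumed nonzero), let $\ell^T$ be the $p$-th row of $\mathbf{L}_{21}$ and $u$ the $q$-th column of $\mathbf{U}_{12}$, and put $$\overline{\mathbf{A}}_{11}=\begin{pmatrix}\mathbf{L}_{11}&0\\ \ell^T&1\end{pmatrix}\begin{pmatrix}\mathbf{U}_{11}&u\\0&\alpha\end{pmatrix}\in\mathbb{R}^{(k+1)\times(k+1)}.$$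 While $\|\overline{\mathbf{A}}_{11}^{-1}\|_{\max}>f/|\alpha|$, SRP swaps the row and column containing $\alpha$ with the row and column corresponding to the largest-magnitude entry of $\overline{\mathbf{A}}_{11}^{-1}$, and updates the truncated LU factorization and $\alpha$. A rank-$k$ SRLU factorization produced by SRP is the truncated LU factorization at termination, i.e. one satisfying $$\|\overline{\mathbf{A}}_{11}^{-1}\|_{\max}\le\frac{f}{|\alpha|}.$$ Here $\|\cdot\|_{\max}$ is the largest absolute value of an entry, $\sigma_1(\cdot)\ge\sigma_2(\cdot)\ge\cdots$ are the singular values, $\|\cdot\|_2$ is the spectral norm, and $(\cdot)_j$ is the rank-$j$ truncated SVD. *)

(* Defs.v *)
(* MathComp / MathComp-Analysis *)
From mathcomp Require Import all_boot all_order all_algebra all_fingroup.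
From mathcomp Require Import polyrcf.
From mathcomp Require Import boolp classical_sets reals matrix_normedtype.

Set Implicit Arguments.
Unset Strict Implicit.
Unset Printing Implicit Defensive.

Import Order.TTheory GRing.Theory Num.Theory.
Local Open Scope ring_scope.

Definition euclidean_norm (R : realType) (n : nat) (x : 'cV[R]_n) : R :=
  Num.sqrt (\sum_i x i 0 ^+ 2).

Definition spectral_norm (R : realType) (m n : nat) (M : 'M[R]_(m, n)) : R :=
  sup [set euclidean_norm (M *m x) | x in
        [set x : 'cV[R]_n | euclidean_norm x <= 1]]%classic.

(* Real eigenvalues, repeated according to their algebraic multiplicity. *)
Definition eigenvalues (R : realType) (n : nat) (M : 'M[R]_n) : seq R :=
  flatten [seq nseq (mup x (char_poly M)) x | x <- rootsR (char_poly M)].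

Definition singular_values (R : realType) (m n : nat) (M : 'M[R]_(m, n)) :
    seq R :=
  sort (fun x y => y <= x) [seq Num.sqrt x | x <- eigenvalues (M^T *m M)].

(* Indices start at 1; sigma M i is 0 for i > n. *)
Definition sigma (R : realType) (m n : nat) (M : 'M[R]_(m, n)) (i : nat) : R :=
  nth 0 (singular_values M) i.-1.

Definition orthogonal_mx (R : realType) (n : nat) (Q : 'M[R]_n) : Prop :=
  Q^T *m Q = 1%:M.

(* The m x n diagonal matrix of the first r singular values of M, which are
   followed by zeros; r = minn m n keeps them all. *)
Definition Sigma_mx (R : realType) (m n : nat) (M : 'M[R]_(m, n)) (r : nat) :
    'M[R]_(m, n) :=
  \matrix_(i, j) (if (i == j :> nat) && (i < r)%N then sigma M i.+1 else 0).

Definition is_svd (R : realType) (m n : nat) (M : 'M[R]_(m, n))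
    (U : 'M[R]_m) (V : 'M[R]_n) : Prop :=
  [/\ orthogonal_mx U, orthogonal_mx V & M = U *m Sigma_mx M (minn m n) *m V^T].

(* A relation, because the truncation depends on the chosen SVD when
   sigma M r = sigma M r.+1. *)
Definition is_truncated_svd (R : realType) (m n : nat) (r : nat)
    (M Mr : 'M[R]_(m, n)) : Prop :=
  exists (U : 'M[R]_m) (V : 'M[R]_n),
    is_svd M U V /\ Mr = U *m Sigma_mx M r *m V^T.

(* lu_m and lu_n stand for m - k and n - k; the casts identify k + lu_m with m
   and k + lu_n with n. *)
Record truncated_LU (R : realType) (m n k : nat) (A : 'M[R]_(m, n)) :=
  TruncatedLU {
    lu_m : nat;
    lu_n : nat;
    lu_eqm : (k + lu_m = m)%N;
    lu_eqn : (k + lu_n = n)%N;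
    lu_s1 : 'S_m;
    lu_s2 : 'S_n;
    L11 : 'M[R]_k;
    L21 : 'M[R]_(lu_m, k);
    U11 : 'M[R]_k;
    U12 : 'M[R]_(k, lu_n);
    schur : 'M[R]_(lu_m, lu_n);
    L11_lower : is_trig_mx L11;
    L11_unit_diag : forall i, L11 i i = 1;
    U11_upper : is_trig_mx U11^T;
    U11_unit : U11 \in unitmx;
    lu_eq : perm_mx lu_s1 *m A *m (perm_mx lu_s2)^T =
      castmx (lu_eqm, lu_eqn)
        (block_mx L11 0 L21 1%:M *m block_mx U11 U12 0 schur)
  }.

Section SRLU.
Variables (R : realType) (m n k : nat) (A : 'M[R]_(m, n)).
Variable F : truncated_LU k A.

Definition Pi1 : 'M[R]_m := perm_mx (lu_s1 F).
Definition Pi2 : 'M[R]_n := perm_mx (lu_s2 F).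

Definition Lhat : 'M[R]_(m, k) :=
  castmx (lu_eqm F, erefl k) (col_mx (L11 F) (L21 F)).

Definition Uhat : 'M[R]_(k, n) :=
  castmx (erefl k, lu_eqn F) (row_mx (U11 F) (U12 F)).

Definition A11bar (p : 'I_(lu_m F)) (q : 'I_(lu_n F)) : 'M[R]_(k + 1) :=
  block_mx (L11 F) 0 (row p (L21 F)) 1%:M *m
  block_mx (U11 F) (col q (U12 F)) 0 (schur F p q)%:M.

(* The exit condition of spectrum-revealing pivoting with tolerance f;
   (p, q) is the position of the pivot alpha in the Schur complement, and
   mx_norm is the largest absolute value of an entry. *)
Definition is_SRLU (f : R) : Prop :=
  exists (p : 'I_(lu_m F)) (q : 'I_(lu_n F)),
    [/\ forall i j, `|schur F i j| <= `|schur F p q|,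
        schur F p q != 0 &
        mx_norm (invmx (A11bar p q)) <= f / `|schur F p q|].

End SRLU.

(* Main.v *)
Require Import Defs.
From mathcomp Require Import all_boot all_order all_algebra all_fingroup.
From mathcomp Require Import polyrcf complex spectral sesquilinear.
From mathcomp Require Import classical_sets reals matrix_normedtype.
From mathcomp Require Import ring lra.

(** The residual [Pi1 A Pi2^T - L U] is the Schur complement [S] padded with
    zeros, so its spectral norm is at most [sqrt (m n) |alpha|], where [alpha]
    is the largest entry of [S].  The exit condition of the pivoting controls
    [alpha] because the bordered matrix [A11bar] is a [(k+1) x (k+1)]
    submatrix of [A] up to row and column permutations, and passing to a
    submatrix does not increase singular values:
      [sigma_{k+1}(A) >= sigma_min(A11bar) = 1 / ||A11bar^-1||_2
                      >= 1 / ((k+1) ||A11bar^-1||_max)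
                      >= |alpha| / ((k+1) f)]
    ([sigma_ge_unit_submatrix]).  Hence [gamma := f (k+1) sqrt (m n)] works
    for the first estimate, and [k + 1 <= 2 k] gives the constant [C = 2].

    For the second estimate write
      [B - (LU)_j = (B - LU) + (LU - (LU)_j)]   with [B := Pi1 A Pi2^T].
    The second summand has norm [sigma_{j+1}(LU)] ([truncation_error]), and
    Weyl's perturbation inequality ([sigma_perturbation]) bounds this by
    [sigma_{j+1}(A) + ||B - LU|| <= sigma_{j+1}(A) + gamma sigma_{k+1}(A)].

    Both the submatrix bound and Weyl's inequality follow from one half of the
    Courant-Fischer principle, [sigma_ge_embedding]: a matrix that stretches
    every vector of an [r]-dimensional subspace by a factor at least [c] has
    [sigma_r >= c].  As the singular values are defined through the roots of
    the characteristic polynomial of the Gram matrix, that principle rests on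
    the spectral theorem for real symmetric matrices, obtained from the
    complex one ([real_symmetric_spectral]). *)

Set Implicit Arguments.
Unset Strict Implicit.
Unset Printing Implicit Defensive.

Import Order.TTheory GRing.Theory Num.Theory.
Local Open Scope ring_scope.

(** * Euclidean norms *)

Section EuclideanNorm.
Variable R : realType.

Definition sqnorm n (x : 'cV[R]_n) : R := \sum_i x i 0 ^+ 2.

Lemma sqnorm_ge0 n (x : 'cV[R]_n) : 0 <= sqnorm x.
Proof. by apply: sumr_ge0 => i _; exact: sqr_ge0. Qed.

Lemma sqnorm_eq0 n (x : 'cV[R]_n) : (sqnorm x == 0) = (x == 0).
Proof.
rewrite psumr_eq0; last by move=> i _; exact: sqr_ge0.
apply/allP/eqP => [x0|-> i _ /=]; last by rewrite mxE expr0n.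
apply/colP => i; rewrite mxE.
by have := x0 i (mem_index_enum _); rewrite /= sqrf_eq0 => /eqP.
Qed.

Lemma sqnormE n (x : 'cV[R]_n) : sqnorm x = (x^T *m x) 0 0.
Proof. by rewrite mxE; apply: eq_bigr => i _; rewrite mxE expr2. Qed.

Lemma sqnorm_isometry m n (E : 'M[R]_(m, n)) (x : 'cV_n) :
  E^T *m E = 1%:M -> sqnorm (E *m x) = sqnorm x.
Proof.
by move=> EE; rewrite !sqnormE trmx_mul -mulmxA (mulmxA E^T) EE mul1mx.
Qed.

Lemma euclidean_norm_ge0 n (x : 'cV[R]_n) : 0 <= euclidean_norm x.
Proof. exact: sqrtr_ge0. Qed.

Lemma sqr_euclidean_norm n (x : 'cV[R]_n) : euclidean_norm x ^+ 2 = sqnorm x.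
Proof. by rewrite sqr_sqrtr // sqnorm_ge0. Qed.

Lemma euclidean_norm_le n p (x : 'cV[R]_n) (y : 'cV[R]_p) (c : R) :
  0 <= c ->
  (euclidean_norm x <= c * euclidean_norm y) = (sqnorm x <= c ^+ 2 * sqnorm y).
Proof.
move=> c0; rewrite -ler_sqr ?nnegrE ?mulr_ge0 ?euclidean_norm_ge0 //.
by rewrite exprMn !sqr_euclidean_norm.
Qed.

Lemma euclidean_norm_ge n p (x : 'cV[R]_n) (y : 'cV[R]_p) (c : R) :
  0 <= c ->
  (c * euclidean_norm y <= euclidean_norm x) = (c ^+ 2 * sqnorm y <= sqnorm x).
Proof.
move=> c0; rewrite -ler_sqr ?nnegrE ?mulr_ge0 ?euclidean_norm_ge0 //.
by rewrite exprMn !sqr_euclidean_norm.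
Qed.

Lemma euclidean_norm_isometry m n (E : 'M[R]_(m, n)) (x : 'cV_n) :
  E^T *m E = 1%:M -> euclidean_norm (E *m x) = euclidean_norm x.
Proof. by move=> EE; congr Num.sqrt; exact: sqnorm_isometry. Qed.

(** Lagrange's identity: the difference of the two sides is half the double sum
    of the squares [(a_i b_j - a_j b_i)^2]. *)
Lemma cauchy_schwarz (I : finType) (a b : I -> R) :
  (\sum_i a i * b i) ^+ 2 <= (\sum_i a i ^+ 2) * (\sum_i b i ^+ 2).
Proof.
have : 0 <= \sum_i \sum_j (a i * b j - a j * b i) ^+ 2.
  by apply: sumr_ge0 => i _; apply: sumr_ge0 => j _; exact: sqr_ge0.
have -> : \sum_i \sum_j (a i * b j - a j * b i) ^+ 2 =
   \sum_i \sum_j (a i ^+ 2 * b j ^+ 2) + \sum_i \sum_j (a j ^+ 2 * b i ^+ 2) -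
   2 * \sum_i \sum_j ((a i * b i) * (a j * b j)).
  rewrite mulr_sumr -big_split -sumrB /=; apply: eq_bigr => i _.
  rewrite mulr_sumr -big_split -sumrB /=; apply: eq_bigr => j _.
  by ring.
rewrite [X in _ + X - _]exchange_big /=.
under eq_bigr do rewrite -mulr_sumr.
under [X in 2 * X]eq_bigr do rewrite -mulr_sumr.
rewrite -!mulr_suml; lra.
Qed.

Lemma euclidean_normD n (x y : 'cV[R]_n) :
  euclidean_norm (x + y) <= euclidean_norm x + euclidean_norm y.
Proof.
rewrite -ler_sqr ?nnegrE ?addr_ge0 ?euclidean_norm_ge0 //.
rewrite sqrrD !sqr_euclidean_norm.
have -> : sqnorm (x + y) =
    sqnorm x + (\sum_i x i 0 * y i 0) *+ 2 + sqnorm y.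
  rewrite -sumrMnl /sqnorm -!big_split /=.
  by apply: eq_bigr => i _; rewrite mxE sqrrD.
rewrite lerD2r lerD2l lerMn2r /=.
rewrite (le_trans (ler_norm _)) //.
rewrite -ler_sqr ?nnegrE ?mulr_ge0 ?euclidean_norm_ge0 //.
rewrite real_normK ?num_real // exprMn !sqr_euclidean_norm.
exact: cauchy_schwarz.
Qed.

(** Cauchy-Schwarz in each row bounds the operator norm by the Frobenius norm,
    which is at most [sqrt (m n)] times the largest entry. *)
Lemma euclidean_norm_mulmx m n (M : 'M[R]_(m, n)) (c : R) (x : 'cV_n) :
  (forall i j, `|M i j| <= c) ->
  euclidean_norm (M *m x) <= Num.sqrt (m * n)%:R * c * euclidean_norm x.
Proof.
move=> Mc; case: (posnP m) => [m0|m0].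
  rewrite m0 in M Mc *.
  by rewrite /euclidean_norm big_ord0 mul0n sqrtr0 !mul0r.
case: (posnP n) => [n0|n0].
  rewrite n0 in M Mc x *.
  by rewrite thinmx0 mul0mx muln0 sqrtr0 !mul0r {1}/euclidean_norm big1 ?sqrtr0
    // => i _; rewrite mxE expr0n.
(* With both dimensions positive there is an entry, which forces [0 <= c]. *)
have c0 : 0 <= c.
  exact: le_trans (normr_ge0 _) (Mc (Ordinal m0) (Ordinal n0)).
rewrite euclidean_norm_le ?mulr_ge0 ?sqrtr_ge0 //.
rewrite exprMn sqr_sqrtr ?ler0n // natrM -2!mulrA mulr_natl.
rewrite -[X in _ *+ X]card_ord -sumr_const; apply: ler_sum => i _.
rewrite mxE (le_trans (cauchy_schwarz _ _)) // [leRHS]mulrA.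
rewrite ler_wpM2r ?sqnorm_ge0 //.
rewrite mulr_natl -[X in _ *+ X]card_ord -sumr_const; apply: ler_sum => j _.
by rewrite -real_normK ?num_real // ler_sqr ?nnegrE.
Qed.

Lemma spectral_norm_le m n (M : 'M[R]_(m, n)) (c : R) :
  0 <= c -> (forall x, euclidean_norm (M *m x) <= c * euclidean_norm x) ->
  spectral_norm M <= c.
Proof.
move=> c0 Mc; apply: ge_sup.
  exists (euclidean_norm (M *m 0)), 0 => //=.
  by rewrite /euclidean_norm big1 ?sqrtr0 // => i _; rewrite mxE expr0n.
move=> _ [x /= x1 <-]; apply: le_trans (Mc x) _.
by rewrite ler_piMr.
Qed.

End EuclideanNorm.

(** * Eigenvalues of real symmetric matrices *)

Lemma count_mem_flatten_nseq (T : eqType) (f : T -> nat) (r : seq T) (x : T) :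
  uniq r -> count_mem x (flatten [seq nseq (f y) y | y <- r]) =
            ((x \in r) * f x)%N.
Proof.
elim: r => //= y r IHr /andP[yr /IHr IH].
rewrite count_cat count_nseq /= IH inE.
by have [->|] := eqVneq x y; rewrite ?(negPf yr) ?addn0 ?eqxx.
Qed.

Lemma perm_eigenvalues (R : realType) n (N : 'M[R]_n) (s : seq R) :
  char_poly N = \prod_(x <- s) ('X - x%:P) -> perm_eq (eigenvalues N) s.
Proof.
move=> Ns; apply/allP => x _ /=; apply/eqP.
have p0 : char_poly N != 0 by rewrite monic_neq0 ?char_poly_monic.
rewrite /eigenvalues count_mem_flatten_nseq ?uniq_roots //.
have -> : (x \in rootsR (char_poly N)) = root (char_poly N) x.
  by rewrite -roots_on_rootsR // in_itv.
rewrite -[RHS]mu_prod_XsubC -Ns.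
by case: (boolP (root _ _)) => [_|/mupNroot->]; rewrite ?mul1n ?muln0.
Qed.

Lemma char_poly_conj (F : fieldType) n (P N : 'M[F]_n) :
  P \in unitmx -> char_poly (invmx P *m N *m P) = char_poly N.
Proof.
move=> Pu; rewrite /char_poly.
have -> : char_poly_mx (invmx P *m N *m P) =
    map_mx polyC (invmx P) *m char_poly_mx N *m map_mx polyC P.
  rewrite /char_poly_mx !map_mxM mulmxBr mulmxBl; congr (_ - _).
  by rewrite mul_mx_scalar -scalemxAl -map_mxM mulVmx // map_mx1 scalemx1.
rewrite !det_mulmx mulrAC -[X in X * _]det_mulmx -map_mxM mulVmx //.
by rewrite map_mx1 det1 mul1r.
Qed.

Section SpectralTheorem.
Variable R : realType.
Local Open Scope sesquilinear_scope.

(** The diagonalizing basis is left complex: the min-max principle only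
    uses squared moduli of coordinates in it, so the complex spectral theorem
    applies as it stands.  The eigenvalues themselves are real, and the
    characteristic polynomial, which splits as the product of the
    [X - e_i] over the complex numbers, already does so over [R]; this
    identifies them with the list [eigenvalues N], multiplicities included. *)
Lemma real_symmetric_spectral n (N : 'M[R]_n) :
  N^T = N ->
  exists (P : 'M[R[i]]_n) (e : 'rV[R]_n),
    [/\ P \is unitarymx,
        map_mx (real_complex R) N =
          P^t* *m diag_mx (map_mx (real_complex R) e) *m P &
        perm_eq (eigenvalues N) [seq e 0 i | i <- enum 'I_n]].
Proof.
move=> Ns; set NC := map_mx _ N.
have NCh : NC \is hermsymmx.
  apply: realsym_hermsym.
    apply/is_hermitianmxP.
    by rewrite expr0 scale1r map_mx_id // /NC map_trmx Ns.
  by apply/mxOverP => i j; rewrite mxE; apply/complex_realP; exists (N i j).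
have dR := hermitian_spectral_diag_real NCh.
have /orthomx_spectralP := hermitian_normalmx NCh.
set P := spectralmx NC; set d := spectral_diag NC in dR * => eN.
have Pu : P \is unitarymx := spectral_unitarymx NC.
(* The eigenvalues are real, hence images of their real parts. *)
pose e := map_mx (@complex.Re R) d.
have ed : map_mx (real_complex R) e = d.
  apply/matrixP => i j; rewrite !mxE; apply: RRe_real.
  by move/mxOverP: dR => /(_ i j).
exists P, e; split => //; first by rewrite ed -invmx_unitary.
apply: perm_eigenvalues.
apply: (@map_poly_inj _ _ (real_complex R)).
rewrite map_char_poly -/NC eN char_poly_conj ?unitarymx_unit //.
rewrite char_poly_trig ?diag_mx_is_trig // big_map big_enum /= rmorph_prod.
apply: eq_bigr => i _.
rewrite rmorphB /= map_polyX map_polyC /=; congr (_ - _%:P).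
by rewrite !mxE eqxx mulr1n -[in LHS]ed mxE mxE.
Qed.

End SpectralTheorem.

(** * A min-max principle for singular values *)

Section MinMax.
Variable R : realType.
Local Open Scope sesquilinear_scope.

Lemma count_gt_nth (s : seq R) (i : nat) :
  sorted (fun x y => y <= x) s -> (count (fun x => (nth 0 s i < x)%R) s <= i)%N.
Proof.
move=> ss; rewrite -[X in count _ X](cat_take_drop i s) count_cat.
rewrite [X in (_ + X)%N](_ : _ = 0%N) ?addn0; last first.
  apply/eqP; rewrite -leqn0 leqNgt -has_count -all_predC; apply/allP => x.
  move=> /(nthP 0)[l]; rewrite size_drop ltn_subRL => ls <- /=.
  rewrite nth_drop -leNgt.
  apply: (sorted_leq_nth _ _ _ ss) => //.
  - by move=> a b c ab bc; apply: le_trans bc ab.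
  - by rewrite inE (leq_ltn_trans _ ls) ?leq_addr.
  - by rewrite leq_addr.
by rewrite (leq_trans (count_size _ _)) // size_take_min geq_minl.
Qed.

Lemma sigma_ge0 m n (M : 'M[R]_(m, n)) i : 0 <= sigma M i.
Proof.
rewrite /sigma; have [lt|?] := ltnP i.-1 (size (singular_values M)).
  have := mem_nth 0 lt; rewrite mem_sort => /mapP[x _ ->].
  exact: sqrtr_ge0.
by rewrite nth_default.
Qed.

Lemma sorted_singular_values m n (M : 'M[R]_(m, n)) :
  sorted (fun x y => y <= x) (singular_values M).
Proof. by apply: sort_sorted => x y; exact: le_total. Qed.

Lemma sigma_anti m n (M : 'M[R]_(m, n)) i j :
  (0 < i)%N -> (i <= j)%N -> sigma M j <= sigma M i.
Proof.
move=> i0 ij; have [lt|ge] := ltnP j.-1 (size (singular_values M)); last first.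
  by rewrite /sigma nth_default // sigma_ge0.
have ij' : (i.-1 <= j.-1)%N by rewrite -!subn1 leq_sub2r.
apply: (sorted_leq_nth _ _ _ (sorted_singular_values M)) => //.
- by move=> a b c ab bc; apply: le_trans bc ab.
- by rewrite inE (leq_ltn_trans ij').
Qed.

(** An eigenvalue above the square of [sigma M r] is positive, so its square
    root exceeds [sigma M r], and at most [r - 1] entries of the decreasing list
    of singular values lie strictly above the [r]-th one. *)
Lemma card_eigen_gt_sigma m n (M : 'M[R]_(m, n)) (e : 'rV[R]_n) r :
  perm_eq (eigenvalues (M^T *m M)) [seq e 0 i | i <- enum 'I_n] ->
  (#|[pred i | (sigma M r ^+ 2 < e 0 i)%R]| <= r.-1)%N.
Proof.
move=> pe.
apply: leq_trans (count_gt_nth r.-1 (sorted_singular_values M)).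
rewrite -/(sigma M r).
have /seq.permP-> : perm_eq (singular_values M)
    (map Num.sqrt [seq e 0 i | i <- enum 'I_n]).
  by rewrite perm_sort; exact: perm_map.
rewrite -map_comp count_map enumT cardE /enum_mem size_filter.
apply: sub_count => i; rewrite !inE /= => lt.
rewrite -[sigma M r]ger0_norm ?sigma_ge0 // -sqrtr_sqr ltr_sqrt //.
by rewrite (le_lt_trans _ lt) ?sqr_ge0.
Qed.

Local Notation toC := (map_mx (real_complex R)).
Local Notation ReM := (map_mx (@complex.Re R)).
Local Notation ImM := (map_mx (@complex.Im R)).

Lemma sqnormC n (v : 'cV[R[i]]_n) :
  (v^t* *m v) 0 0 = real_complex R (sqnorm (ReM v) + sqnorm (ImM v)).
Proof.
rewrite /sqnorm -big_split rmorph_sum mxE; apply: eq_bigr => i _ /=.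
by rewrite !mxE add_Re2_Im2 sqr_normc mulrC.
Qed.

Lemma Re_mulmx m n (M : 'M[R]_(m, n)) (v : 'cV[R[i]]_n) :
  ReM (toC M *m v) = M *m ReM v.
Proof.
apply/colP => i; rewrite !mxE.
rewrite (big_morph (@complex.Re R) (id1 := 0) (op1 := +%R)) //; last first.
  by case=> ? ? [? ?].
apply: eq_bigr => l _; rewrite !mxE; case: (v l 0) => a b /=.
by rewrite mul0r subr0.
Qed.

Lemma Im_mulmx m n (M : 'M[R]_(m, n)) (v : 'cV[R[i]]_n) :
  ImM (toC M *m v) = M *m ImM v.
Proof.
apply/colP => i; rewrite !mxE.
rewrite (big_morph (@complex.Im R) (id1 := 0) (op1 := +%R)) //; last first.
  by case=> ? ? [? ?].
apply: eq_bigr => l _; rewrite !mxE; case: (v l 0) => a b /=.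
by rewrite mul0r addr0.
Qed.

Lemma exists_kernel (F : fieldType) p r (K : 'M[F]_(p, r)) :
  (p < r)%N -> exists2 y : 'cV_r, y != 0 & K *m y = 0.
Proof.
move=> pr.
have : kermx K^T != 0.
  rewrite -mxrank_eq0 mxrank_ker subn_eq0 -ltnNge mxrank_tr.
  exact: leq_ltn_trans (rank_leq_row _) pr.
move=> /rowV0Pn[v /sub_kermxP vK v0]; exists v^T; first by rewrite trmx_eq0.
by apply: trmx_inj; rewrite trmx_mul trmxK vK trmx0.
Qed.

(** One half of the Courant-Fischer principle; the columns of [E] are an
    orthonormal basis of the subspace.  Fewer than [r] eigenvalues of [M^T M]
    exceed [sigma_r^2], so the subspace contains a nonzero vector orthogonal to
    their eigenvectors, which [M] stretches by [sigma_r] at most.  The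
    eigenvectors being complex, this vector is found in the complexified
    subspace, where the hypothesis still holds because [M] and [E] are real and
    so act separately on real and imaginary parts. *)
Lemma sigma_ge_embedding m n r (M : 'M[R]_(m, n)) (E : 'M_(n, r)) (c : R) :
  (0 < r)%N -> E^T *m E = 1%:M ->
  (forall y, c * euclidean_norm y <= euclidean_norm (M *m (E *m y))) ->
  c <= sigma M r.
Proof.
move=> r0 EE cE; have [c0|/ltW c0] := leP 0 c; last first.
  exact: le_trans c0 (sigma_ge0 _ _).
have cE2 y : c ^+ 2 * sqnorm y <= sqnorm (M *m (E *m y)).
  by rewrite -euclidean_norm_ge.
set t := sigma M r.
have Ns : (M^T *m M)^T = M^T *m M by rewrite trmx_mul trmxK.
have [P [e [Pu eN pe]]] := real_symmetric_spectral Ns.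
(* [T] indexes the eigenvalues above [t^2]; there are fewer than [r], so some
   complex combination [x] of the columns of [E] has no component on them. *)
have := card_eigen_gt_sigma r pe; rewrite -/t; set T := [pred i | _] => Tr.
have {}Tr : (#|T| < r)%N by rewrite (leq_ltn_trans Tr) // prednK.
have [y y0 Ky] := exists_kernel (rowsub (@enum_val _ T) (P *m toC E)) Tr.
set x := toC E *m y; set Q := P *m x.
have Q0 i : i \in T -> Q i 0 = 0.
  move=> iT; have /colP/(_ (enum_rank_in iT i)) := Ky.
  rewrite mul_rowsub_mx [X in X = _]mxE enum_rankK_in // -mulmxA => ->.
  by rewrite mxE.
have PP : P^t* *m P = 1%:M.
  by rewrite -invmx_unitary // mulVmx // unitarymx_unit.
have adj p q (A : 'M[R[i]]_(p, q)) (B : 'cV_q) : (A *m B)^t* = B^t* *m A^t*.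
  by rewrite trmx_mul map_mxM.
have toCa p q (A : 'M[R]_(p, q)) : (toC A)^t* = toC A^T.
  by apply/matrixP => i j; rewrite !mxE; exact: conjc_real.
have quad : ((toC M *m x)^t* *m (toC M *m x)) 0 0 <=
    real_complex R (t ^+ 2) * (Q^t* *m Q) 0 0.
  have -> : (toC M *m x)^t* *m (toC M *m x) =
      Q^t* *m (diag_mx (toC e) *m Q).
    rewrite adj toCa mulmxA -(mulmxA _ (toC M^T)) -map_mxM eN.
    by rewrite -!mulmxA -/x -/Q !mulmxA -adj.
  rewrite [X in X <= _]mxE [X in _ * X]mxE mulr_sumr.
  apply: ler_sum => i _; rewrite mul_diag_mx.
  have -> : Q^t* 0 i = conjc (Q i 0) by rewrite !mxE.
  rewrite [X in _ * X <= _]mxE [_ 0 i]mxE.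
  have [iT|] := boolP (i \in T); first by rewrite (Q0 _ iT) !mulr0.
  rewrite inE -leNgt => le.
  rewrite mulrCA ler_wpM2r ?lecR // mulrC -sqr_normc.
  exact: exprn_ge0.
(* [P] and [E] preserve the norm, so [Q], [x] and [y] have the same one. *)
have QQ : (Q^t* *m Q) 0 0 = (y^t* *m y) 0 0.
  rewrite adj -mulmxA (mulmxA _ P) PP mul1mx adj toCa -mulmxA (mulmxA (toC _)).
  by rewrite -map_mxM EE map_mx1 mul1mx.
move: quad; rewrite QQ !sqnormC -rmorphM lecR => quad.
have s0 : 0 < sqnorm (ReM y) + sqnorm (ImM y).
  rewrite lt_def addr_ge0 ?sqnorm_ge0 // andbT paddr_eq0 ?sqnorm_ge0 //.
  rewrite !sqnorm_eq0; apply: contra y0 => /andP[/eqP/colP a /eqP/colP b].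
  apply/eqP/colP => i; rewrite [y i 0]complexE.
  have := a i; have := b i; rewrite !mxE => -> ->.
  by rewrite /= mulr0 addr0.
(* The hypothesis applies to the real and the imaginary part of [y]. *)
have : c ^+ 2 * (sqnorm (ReM y) + sqnorm (ImM y)) <=
       t ^+ 2 * (sqnorm (ReM y) + sqnorm (ImM y)).
  apply: le_trans quad; rewrite !Re_mulmx !Im_mulmx mulrDr.
  by rewrite lerD // !Re_mulmx !Im_mulmx; exact: cE2.
by rewrite ler_pM2r // ler_sqr ?nnegrE ?sigma_ge0.
Qed.

End MinMax.

(** * Submatrices and orthogonal equivalence *)

Section Submatrix.
Variable R : realType.

Lemma colsub_isometry n r (g : 'I_r -> 'I_n) :
  injective g -> (colsub g (1%:M : 'M[R]_n))^T *m colsub g 1%:M = 1%:M.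
Proof.
move=> gi; rewrite mulmx_colsub mulmx1; apply/matrixP => a b.
by rewrite !mxE (inj_eq gi) eq_sym.
Qed.

Lemma euclidean_norm_rowsub m r (f : 'I_r -> 'I_m) (v : 'cV[R]_m) :
  injective f -> euclidean_norm (rowsub f v) <= euclidean_norm v.
Proof.
move=> fi; rewrite ler_sqrt ?sqnorm_ge0 //.
under eq_bigr do rewrite mxE.
rewrite -(big_imset (fun i => v i 0 ^+ 2)) /=; last by move=> ? ? _ _ /fi.
rewrite [leLHS]big_mkcond; apply: ler_sum => i _.
by case: ifP => // _; exact: sqr_ge0.
Qed.

(** The columns [g] select the subspace spanned by the corresponding coordinate
    vectors, and dropping the rows outside [f] only shortens vectors. *)
Lemma sigma_ge_submatrix m n r (M : 'M[R]_(m, n)) (f : 'I_r -> 'I_m)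
    (g : 'I_r -> 'I_n) (c : R) :
  (0 < r)%N -> injective f -> injective g ->
  (forall y, c * euclidean_norm y <= euclidean_norm (mxsub f g M *m y)) ->
  c <= sigma M r.
Proof.
move=> r0 fi gi cM; apply: (sigma_ge_embedding r0 (colsub_isometry gi)) => y.
apply: le_trans (cM y) _; apply: le_trans (euclidean_norm_rowsub _ fi).
by rewrite mulmxA mulmx_colsub mulmx1 -mul_rowsub_mx -mxsub_comp.
Qed.

Lemma mx_norm_entry m n (M : 'M[R]_(m, n)) i j : `|M i j| <= mx_norm M.
Proof. by rewrite mx_normrE; apply: (le_bigmax _ _ (i, j)). Qed.

(** The submatrix stretches every vector by at least the inverse of the norm of
    its inverse, and that norm is at most [r] times the largest entry. *)
Lemma sigma_ge_unit_submatrix m n r (M : 'M[R]_(m, n)) (f : 'I_r -> 'I_m)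
    (g : 'I_r -> 'I_n) (mu : R) :
  (0 < r)%N -> injective f -> injective g ->
  mxsub f g M \in unitmx -> 0 < mu -> mx_norm (invmx (mxsub f g M)) <= mu ->
  1 <= r%:R * mu * sigma M r.
Proof.
move=> r0 fi gi; set B := mxsub f g M => Bu mu0 Bmu.
have rmu : 0 < r%:R * mu by rewrite mulr_gt0 ?ltr0n.
rewrite mulrC -ler_pdivrMr // div1r.
apply: (sigma_ge_submatrix r0 fi gi) => y; rewrite -/B mulrC ler_pdivrMr //.
rewrite -{1}[y](mulKmx Bu) mulrC.
have -> : r%:R * mu = Num.sqrt (r * r)%:R * mu.
  by rewrite natrM -expr2 sqrtr_sqr ger0_norm.
apply: euclidean_norm_mulmx => i j; exact: le_trans (mx_norm_entry _ i j) Bmu.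
Qed.

Lemma orthogonal_perm_mx n (s : 'S_n) : orthogonal_mx (perm_mx s : 'M[R]_n).
Proof. by rewrite /orthogonal_mx tr_perm_mx -perm_mxM mulVg perm_mx1. Qed.

(** The two Gram matrices are similar. *)
Lemma sigma_orthogonal m n (A : 'M[R]_(m, n)) (U : 'M_m) (V : 'M_n) i :
  orthogonal_mx U -> orthogonal_mx V -> sigma (U *m A *m V^T) i = sigma A i.
Proof.
move=> UU VV.
have [VTu _] := mulmx1_unit VV.
have VE : V = invmx V^T by rewrite -[LHS](mulKmx VTu) VV mulmx1.
rewrite /sigma /singular_values /eigenvalues.
have -> : (U *m A *m V^T)^T *m (U *m A *m V^T) =
    invmx V^T *m (A^T *m A) *m V^T.
  rewrite -VE !trmx_mul trmxK -!mulmxA; congr (_ *m (_ *m _)).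
  by rewrite mulmxA UU mul1mx.
by rewrite char_poly_conj.
Qed.

End Submatrix.

(** * Truncated singular value decompositions and perturbation *)

Section TruncatedSVD.
Variable R : realType.

Definition rect_diag_mx m n (s : nat -> R) : 'M[R]_(m, n) :=
  \matrix_(i, j) (if i == j :> nat then s i else 0).

Lemma sqnorm_rect_diag m n (s : nat -> R) (z : 'cV_n) :
  sqnorm (rect_diag_mx m n s *m z) =
  \sum_(l < n) (if (l < m)%N then s l ^+ 2 else 0) * z l 0 ^+ 2.
Proof.
transitivity (\sum_(i < m) \sum_(l < n)
    (if i == l :> nat then s l ^+ 2 * z l 0 ^+ 2 else 0)).
  apply: eq_bigr => i _; rewrite mxE.
  have [lt|ge] := ltnP i n.
    rewrite (bigD1 (Ordinal lt)) //= big1 ?addr0 => [|l ne]; last first.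
      by rewrite mxE ifN ?mul0r // eq_sym.
    rewrite [RHS](bigD1 (Ordinal lt)) //= big1 ?addr0 => [|l ne]; last first.
      by rewrite ifN // eq_sym.
    by rewrite mxE eqxx exprMn.
  have ne (l : 'I_n) : (i == l :> nat) = false.
    by apply/negbTE; rewrite neq_ltn (leq_trans (ltn_ord l) ge) orbT.
  rewrite !big1 ?expr0n // => l _; first by rewrite ne.
  by rewrite mxE ne mul0r.
rewrite exchange_big; apply: eq_bigr => l _ /=.
have [lt|ge] := ltnP l m.
  rewrite (bigD1 (Ordinal lt)) //= eqxx big1 ?addr0 // => i ne.
  by rewrite ifN.
rewrite mul0r big1 // => i _; rewrite ifN // neq_ltn.
by rewrite (leq_trans (ltn_ord i) ge).
Qed.

Lemma Sigma_mx_rect m n (M : 'M[R]_(m, n)) r :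
  Sigma_mx M r =
  rect_diag_mx m n (fun i => if (i < r)%N then sigma M i.+1 else 0).
Proof. by apply/matrixP => i j; rewrite !mxE; case: eqP. Qed.

(** In the singular bases the error is diagonal, and its entries are the
    discarded singular values, of which [sigma M j.+1] is the largest. *)
Lemma truncation_error m n (M Mj : 'M[R]_(m, n)) j (x : 'cV_n) :
  is_truncated_svd j M Mj ->
  euclidean_norm ((M - Mj) *m x) <= sigma M j.+1 * euclidean_norm x.
Proof.
move=> [U [V [[UU VV Me] ->]]].
have VVT : V^T^T *m V^T = 1%:M by rewrite trmxK mulmx1C.
rewrite {1}Me -mulmxBl -mulmxBr -!mulmxA euclidean_norm_isometry //.
rewrite -(euclidean_norm_isometry x VVT); move: (V^T *m x) => z.
rewrite euclidean_norm_le ?sigma_ge0 //.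
have -> : Sigma_mx M (minn m n) - Sigma_mx M j = rect_diag_mx m n
   (fun i => (if (i < minn m n)%N then sigma M i.+1 else 0) -
             (if (i < j)%N then sigma M i.+1 else 0)).
  by rewrite !Sigma_mx_rect; apply/matrixP => a b; rewrite !mxE; case: ifP;
    rewrite ?subr0.
rewrite sqnorm_rect_diag mulr_sumr; apply: ler_sum => l _.
rewrite ler_wpM2r ?sqr_ge0 //; case: ifP => [lm|_]; last exact: sqr_ge0.
rewrite leq_min lm ltn_ord /=; case: ltnP => jl.
  by rewrite subrr expr0n sqr_ge0.
by rewrite subr0 ler_sqr ?nnegrE ?sigma_ge0 // sigma_anti.
Qed.

(** The first [j + 1] right singular vectors span a subspace that realizes
    [sigma M j.+1] in the min-max principle. *)
Lemma svd_embedding m n (M : 'M[R]_(m, n)) U V j :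
  is_svd M U V -> (j < minn m n)%N ->
  exists2 E : 'M_(n, j.+1), E^T *m E = 1%:M &
    forall y, sigma M j.+1 * euclidean_norm y <= euclidean_norm (M *m (E *m y)).
Proof.
move=> [UU VV Me]; rewrite leq_min => /andP[jm jn].
pose g := widen_ord jn; pose J : 'M[R]_(n, j.+1) := colsub g 1%:M.
have JJ : J^T *m J = 1%:M.
  by apply: colsub_isometry => a b [/val_inj].
exists (V *m J) => [|y].
  by rewrite trmx_mul -mulmxA (mulmxA V^T) VV mul1mx.
rewrite {2}Me -!mulmxA euclidean_norm_isometry // (mulmxA V^T) VV mul1mx.
rewrite -(euclidean_norm_isometry y JJ) euclidean_norm_ge ?sigma_ge0 //.
rewrite Sigma_mx_rect sqnorm_rect_diag mulr_sumr; apply: ler_sum => l _.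
have [lj|jl] := leqP l j.
  have lm := leq_ltn_trans lj jm.
  rewrite lm leq_min lm ltn_ord /= ler_wpM2r ?sqr_ge0 //.
  by rewrite ler_sqr ?nnegrE ?sigma_ge0 // sigma_anti.
rewrite [_ l 0](_ : _ = 0) ?expr0n ?mulr0 //.
rewrite mxE big1 // => b _; rewrite !mxE -val_eqE /= gtn_eqF ?mul0r //.
by rewrite (leq_trans (ltn_ord b)).
Qed.

(** Weyl's inequality: on the span of the leading right singular vectors of [M],
    the matrix [N] stretches by at least [sigma M j.+1 - c]. *)
Lemma sigma_perturbation m n (M N : 'M[R]_(m, n)) U V j c :
  is_svd M U V -> (j < minn m n)%N ->
  (forall x, euclidean_norm ((N - M) *m x) <= c * euclidean_norm x) ->
  sigma M j.+1 <= sigma N j.+1 + c.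
Proof.
move=> Msvd jmn NM; rewrite -lerBlDr.
have [E EE ME] := svd_embedding Msvd jmn.
apply: (sigma_ge_embedding _ EE) => // y.
rewrite mulrBl lerBlDr (le_trans (ME y)) //.
rewrite -[X in _ + _ * X](euclidean_norm_isometry y EE).
move: (E *m y) => {}y.
rewrite (_ : M *m y = N *m y + (- (N - M)) *m y); last first.
  by rewrite opprB mulmxBl addrC subrK.
rewrite (le_trans (euclidean_normD _ _)) // lerD2l.
rewrite mulNmx /euclidean_norm (eq_bigr (fun i => ((N - M) *m y) i 0 ^+ 2)).
  exact: NM.
by move=> i _; rewrite [in LHS]mxE sqrrN.
Qed.

End TruncatedSVD.

(** * The bordered pivot block *)

Section PivotBlock.
Variable R : realType.

Definition pivot_index k l (p : 'I_l) (a : 'I_(k + 1)) : 'I_(k + l) :=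
  match split a with inl i => lshift l i | inr _ => rshift k p end.

Lemma pivot_index_inj k l (p : 'I_l) : injective (@pivot_index k l p).
Proof.
move=> a b; rewrite /pivot_index.
case: (split_ordP a) => i ->; case: (split_ordP b) => j -> /eqP.
- by rewrite eq_lshift => /eqP->.
- by rewrite eq_lrshift.
- by rewrite eq_rlshift.
- by rewrite !ord1.
Qed.

(** An entry of a product involves one row of the left factor and one column of
    the right one, so dropping the other rows and columns of the trailing blocks
    does not change it; only the corner also picks up an entry of [S]. *)
Lemma bordered_block_submatrix k lm ln (L11 : 'M[R]_k) (L21 : 'M_(lm, k))
    (U11 : 'M_k) (U12 : 'M_(k, ln)) (S : 'M_(lm, ln)) p q :
  block_mx L11 0 (row p L21) 1%:M *m block_mx U11 (col q U12) 0 (S p q)%:M =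
  mxsub (@pivot_index k lm p) (@pivot_index k ln q)
    (block_mx L11 0 L21 1%:M *m block_mx U11 U12 0 S).
Proof.
rewrite !mulmx_block !mul0mx !mulmx0 !mul1mx !addr0.
apply/matrixP => a b; rewrite [RHS]mxE /pivot_index.
case: (split_ordP a) => i ->; case: (split_ordP b) => j ->;
  rewrite ?ord1 ?(block_mxEul, block_mxEur, block_mxEdl, block_mxEdr) //.
- by rewrite [LHS]mxE [RHS]mxE; apply: eq_bigr => l _; rewrite !mxE.
- by rewrite [LHS]mxE [RHS]mxE; apply: eq_bigr => l _; rewrite !mxE.
- rewrite [LHS]mxE [RHS]mxE [(S p q)%:M 0 0]mxE eqxx [X in X + _]mxE.
  rewrite [X in _ = X + _]mxE.
  by congr (_ + _); apply: eq_bigr => l _; rewrite !mxE.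
Qed.

Lemma unit_bordered_block k (L11 : 'M[R]_k) (l : 'rV_k) (U11 : 'M_k)
    (u : 'cV_k) (a : R) :
  is_trig_mx L11 -> (forall i, L11 i i = 1) -> U11 \in unitmx -> a != 0 ->
  block_mx L11 0 l 1%:M *m block_mx U11 u 0 a%:M \in unitmx.
Proof.
move=> Ltr L1 Uu a0; rewrite unitmxE det_mulmx det_lblock det_ublock.
rewrite det_trig // big1 ?det1 ?mul1r ?det_scalar1 // unitrM -unitmxE Uu /=.
by rewrite unitfE.
Qed.

Lemma perm_conj_mxsub m n (A : 'M[R]_(m, n)) (s : 'S_m) (t : 'S_n) :
  perm_mx s *m A *m (perm_mx t)^T = mxsub s t A.
Proof.
rewrite tr_perm_mx -row_permE -[t in LHS]invgK -col_permE invgK.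
by apply/matrixP => i j; rewrite !mxE.
Qed.

End PivotBlock.

(** * Spectrum-revealing LU *)

Theorem theorem4 (R : realType) :
  exists C : R, 0 < C /\
    forall (m n k : nat) (A : 'M[R]_(m, n)) (f : R) (F : truncated_LU k A),
      (1 <= k)%N -> (k < minn m n)%N -> 1 < f -> is_SRLU F f ->
      exists gamma : R,
        [/\ gamma <= C * f * k%:R * Num.sqrt (m * n)%:R,
            spectral_norm (Pi1 F *m A *m (Pi2 F)^T - Lhat F *m Uhat F)
              <= gamma * sigma A k.+1 &
            forall (j : nat) (LUj : 'M[R]_(m, n)),
              (1 <= j <= k)%N -> is_truncated_svd j (Lhat F *m Uhat F) LUj ->
              spectral_norm (Pi1 F *m A *m (Pi2 F)^T - LUj)
                <= sigma A j.+1 *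
                   (1 + 2 * gamma * (sigma A k.+1 / sigma A j.+1))].
Proof.
exists 2; split => // m n k A f [lm ln em en s1 s2 L11 L21 U11 U12 S] /=.
(* Destructing the dimension equalities turns the casts into identities. *)
move=> Ltr L1 Utr Uu; case: _ / em A s1 => A s1.
case: _ / en A s2 => A s2 => LUe k1 kmn f1.
rewrite /is_SRLU /A11bar /Pi1 /Pi2 /Lhat /Uhat /= !castmx_id.
move=> [p [q [Smax S0 inv]]].
rewrite castmx_id in LUe.
set B := perm_mx s1 *m A *m (perm_mx s2)^T; set LU := _ *m row_mx _ _.
set alpha := `|S p q| in inv Smax.
have f0 : 0 < f by apply: lt_trans f1.
have alpha0 : 0 < alpha by rewrite normr_gt0.
have pivot : alpha <= f * k.+1%:R * sigma A k.+1.
  have := unit_bordered_block (row p L21) (col q U12) Ltr L1 Uu S0.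
  move: inv; rewrite bordered_block_submatrix -LUe perm_conj_mxsub -mxsub_comp.
  move=> inv Au.
  have k10 : (0 < k + 1)%N by rewrite addn1.
  have pi_inj l (s : 'S_(k + l)) i : injective (s \o @pivot_index k l i).
    exact: inj_comp perm_inj (@pivot_index_inj _ _ _).
  have fa0 : 0 < f / alpha by rewrite divr_gt0.
  have := sigma_ge_unit_submatrix k10
    (@pi_inj _ _ _) (@pi_inj _ _ _) Au fa0 inv.
  by rewrite addn1 mulrA mulrAC ler_pdivlMr // mul1r [_ * f]mulrC.
have residual : B - LU = block_mx 0 0 0 S.
  rewrite /B LUe /LU mulmx_block mul_col_row !mul0mx !mulmx0 !mul1mx !addr0.
  by rewrite opp_block_mx add_block_mx !subrr [_ + S]addrC addrK.
(* A nonzero pivot keeps the first [k + 1] singular values of [A] positive, so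
   the quotient in the second estimate is a genuine one. *)
have sk0 : 0 < sigma A k.+1.
  have : 0 < f * k.+1%:R * sigma A k.+1 by apply: lt_le_trans pivot.
  by rewrite pmulr_rgt0 // mulr_gt0 // ltr0n.
pose g := f * k.+1%:R * Num.sqrt ((k + lm) * (k + ln))%:R.
have g0 : 0 <= g by rewrite !mulr_ge0 ?sqrtr_ge0 ?ler0n // ltW.
have resid x : euclidean_norm ((B - LU) *m x) <=
    g * sigma A k.+1 * euclidean_norm x.
  apply: le_trans (euclidean_norm_mulmx (c := alpha) _ _) _.
    move=> i j; rewrite residual.
    case: (split_ordP i) => a ->; case: (split_ordP j) => b ->;
      rewrite (block_mxEul, block_mxEur, block_mxEdl, block_mxEdr) ?mxE ?normr0;
      by [exact: ltW | exact: Smax].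
  rewrite ler_wpM2r ?euclidean_norm_ge0 // mulrC /g mulrAC.
  by rewrite ler_wpM2r ?sqrtr_ge0.
exists g; split.
- rewrite /g ler_wpM2r ?sqrtr_ge0 // [2 * f]mulrC -mulrA ler_pM2l //.
  by rewrite -natrM ler_nat mul2n -addnn -addn1 leq_add2l.
- by apply: spectral_norm_le => //; rewrite mulr_ge0 ?sigma_ge0.
move=> j LUj /andP[j1 jk] tr.
have sj0 : 0 < sigma A j.+1 by apply: lt_le_trans sk0 (sigma_anti _ _ _).
have -> : sigma A j.+1 * (1 + 2 * g * (sigma A k.+1 / sigma A j.+1)) =
    g * sigma A k.+1 + (sigma A j.+1 + g * sigma A k.+1).
  by field; rewrite gt_eqF.
have weyl : sigma LU j.+1 <= sigma A j.+1 + g * sigma A k.+1.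
  have [U [V [svd _]]] := tr.
  rewrite -(sigma_orthogonal A _
    (orthogonal_perm_mx _ s1) (orthogonal_perm_mx _ s2)).
  apply: (sigma_perturbation svd) => //.
  exact: leq_ltn_trans jk kmn.
have gs0 : 0 <= g * sigma A k.+1 by rewrite mulr_ge0 ?sigma_ge0.
apply: spectral_norm_le => [|x].
  by rewrite addr_ge0 // addr_ge0 ?sigma_ge0.
rewrite (_ : B - LUj = (B - LU) + (LU - LUj)); last by rewrite subrKA.
rewrite mulmxDl (le_trans (euclidean_normD _ _)) // mulrDl lerD //.
apply: le_trans (truncation_error x tr) _.
by rewrite ler_wpM2r ?euclidean_norm_ge0.
Qed.
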